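(* Let $\theta\in(\tfrac16,\tfrac56)$ be an irrational number of bounded type, $\lambda=e^{2\pi i\theta}$, and let $c_1=-(1+\sqrt{1-\lambda})^{-1}$ and $c_2=-(1-\sqrt{1-\lambda})^{-1}$, where the branch of the square root is chosen so that $\mathrm{Re}\sqrt{1-\lambda}>0$. Let $\delta=\delta(\theta)>1$ be the constant described in the context. Then: (i) if $\delta\le|\alpha|<+\infty$, then $c_1\in\partial\Delta_\alpha^0$; and (ii) if $0<|\alpha|\le 1/\delta$, then $c_2\in\partial\Delta_\alpha^\infty$.
   Context: An irrational number $\theta$ with continued fraction expansion $[a_0;a_1,a_2,\dots]$ is of bounded type if $\sup_n a_n<\infty$. Put $\lambda=e^{2\pi i\theta}$ and, for $\alpha\in\mathbb{C}\setminus\{0\}$, $f_\alpha(z)=\alpha\,\frac{1+\lambda z}{z+z^2}$. The points $0,\infty$ form a $2$-cycle of $f_\alpha$ with multiplier $\lambda$, and $f_\alpha$ has a $2$-cycle of Siegel disks $\{\Delta_\alpha^0,\Delta_\alpha^\infty\}$, where $\Delta_\alpha^0\ni0$ and $\Delta_\alpha^\infty\ni\infty$ are the Fatou components containing $0$ and $\infty$. The two distinct critical points of $f_\alpha$ are $-(1\pm\sqrt{1-\lambda})^{-1}$, independent of $\alpha$. The constant $\delta=\delta(\theta)>1$ is a number such that, for some labelling $a_1,a_2$ of the two critical points: if $\delta\le|\alpha|<\infty$ then $a_1\in\partial\Delta_\alpha^0$ and $\partial\Delta_\alpha^\infty$ contains no critical point of $f_\alpha$; and if $0<|\alpha|\le1/\delta$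 then $a_2\in\partial\Delta_\alpha^\infty$ and $\partial\Delta_\alpha^0$ contains no critical point of $f_\alpha$. (Such a $\delta$ exists for every bounded type $\theta$.) *)

(* Defs.v *)
From HB Require Import structures.
From mathcomp Require Import all_boot all_order all_algebra.
From mathcomp Require Import all_classical all_reals all_analysis.
From mathcomp Require Import complex.

Set Implicit Arguments.
Unset Strict Implicit.
Unset Printing Implicit Defensive.

Import Order.TTheory GRing.Theory Num.Theory.
Import numFieldNormedType.Exports.

Local Open Scope classical_set_scope.
Local Open Scope complex_scope.
Local Open Scope ring_scope.

(* [R[i]^o] carries the topology of the modulus and is a normed module over
   [R[i]], so that derivatives of maps [R[i]^o -> R[i]^o] are complex ones.
   The point at infinity of the Riemann sphere is [None]. *)
Notation sphere R := (one_point_compactification (R[i]^o)).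

Section sphere.
Variable R : realType.
Implicit Types (p q : sphere R) (f g : sphere R -> sphere R).

Definition boundary (T : topologicalType) (A : set T) : set T :=
  closure A `\` interior A.

Definition chordal p q : R :=
  match p, q with
  | None, None => 0
  | Some z, None | None, Some z =>
      2 / Num.sqrt (1 + Normc.normc z ^+ 2)
  | Some z, Some w =>
      2 * Normc.normc (z - w)
        / Num.sqrt ((1 + Normc.normc z ^+ 2) * (1 + Normc.normc w ^+ 2))
  end.

(* [U] is meant to be open. *)
Definition locally_uniform_cvg (U : set (sphere R))
    (u : nat -> sphere R -> sphere R) g : Prop :=
  forall p, U p -> exists V : set (sphere R), nbhs p V /\
    forall e : R, 0 < e ->
      \forall n \near \oo, forall q, V q -> chordal (u n q) (g q) < e.

Definition normal_family (U : set (sphere R))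
    (F : set (sphere R -> sphere R)) : Prop :=
  forall u : nat -> sphere R -> sphere R, (forall n, F (u n)) ->
    exists phi : nat -> nat, exists g,
      {homo phi : m n / (m < n)%N} /\
      locally_uniform_cvg U (fun n => u (phi n)) g.

Definition fatou f : set (sphere R) :=
  [set p | exists U : set (sphere R),
     [/\ open U, U p & normal_family U (range (fun n => iter n f))]].

Definition fatou_component f p : set (sphere R) :=
  connected_component (fatou f) p.

(* Local coordinate around [p] on the sphere: [z] if [p] is finite, [1 / z] if
   [p] is infinity.  The values at points far away from [p] (infinity in the
   first case, 0 in the second one) are irrelevant. *)
Definition coord p q : R[i]^o :=
  match p, q with
  | Some _, Some z => z
  | Some _, None => 0
  | None, Some z => z^-1
  | None, None => 0
  end.

Definition coord_inv p (w : R[i]^o) : sphere R :=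
  if p is Some _ then Some w else if w == 0 then None else Some w^-1.

Definition critical_point f p : Prop :=
  is_derive (coord p p) (1 : R[i]^o)
    (fun w : R[i]^o => coord (f p) (f (coord_inv p w))) (0 : R[i]^o).

End sphere.

Section continued_fraction.
Variable R : realType.

(* Complete quotients: the expansion is [a_0; a_1, ..., a_(n-1), x_n], where
   a_n is the integer part of x_n. *)
Fixpoint cf_quotient (x : R) (n : nat) : R :=
  if n is m.+1 then
    (cf_quotient x m - (Num.floor (cf_quotient x m))%:~R)^-1
  else x.

Definition cf_digit (x : R) (n : nat) : int := Num.floor (cf_quotient x n).

Definition bounded_type (x : R) : Prop :=
  irrational x /\ exists M : int, forall n, cf_digit x n <= M.

End continued_fraction.

Section family.
Variable R : realType.
Implicit Types (theta delta : R) (lambda alpha : R[i]).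

(* exp (2 i pi theta) *)
Definition rotation theta : R[i] :=
  cos (2 * pi * theta) +i* sin (2 * pi * theta).

(* The values at the poles 0, -1 and at infinity are the right ones as soon as
   [alpha != 0] and [lambda != 1]. *)
Definition fmap lambda alpha (p : sphere R) : sphere R :=
  if p is Some z then
    if z + z ^+ 2 == 0 then None
    else Some (alpha * ((1 + lambda * z) / (z + z ^+ 2)))
  else Some 0.

Definition Delta0 theta alpha : set (sphere R) :=
  fatou_component (fmap (rotation theta) alpha) (Some 0).

Definition Deltaoo theta alpha : set (sphere R) :=
  fatou_component (fmap (rotation theta) alpha) None.

Definition is_delta theta delta : Prop :=
  1 < delta /\
  exists a1 a2 : sphere R,
    [/\ a1 <> a2,
        forall alpha, alpha != 0 -> forall p,
          critical_point (fmap (rotation theta) alpha) p <->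
          p = a1 \/ p = a2,
        forall alpha, delta <= Normc.normc alpha ->
          boundary (Delta0 theta alpha) a1 /\
          (forall p, critical_point (fmap (rotation theta) alpha) p ->
             ~ boundary (Deltaoo theta alpha) p)
      & forall alpha, 0 < Normc.normc alpha <= delta^-1 ->
          boundary (Deltaoo theta alpha) a2 /\
          (forall p, critical_point (fmap (rotation theta) alpha) p ->
             ~ boundary (Delta0 theta alpha) p)].

End family.

(* Main.v *)
Require Import Defs.
From mathcomp Require Import all_boot all_order all_algebra.
From mathcomp Require Import all_classical all_reals all_analysis.
From mathcomp Require Import complex ring lra.
Import Order.TTheory GRing.Theory Num.Theory.
Import numFieldNormedType.Exports.

Set Implicit Arguments.
Unset Strict Implicit.
Unset Printing Implicit Defensive.

Local Open Scope classical_set_scope.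
Local Open Scope complex_scope.
Local Open Scope ring_scope.

(* The two labellings of the critical points differ by whether a1 = c1 or
   a1 = c2, so it suffices to find one alpha with |alpha| >= delta for which c2
   lies in the Fatou set: a Fatou component has no boundary point there.

   As alpha tends to infinity, f_alpha^2 tends to
   lambda z (1 + z) / (1 + lambda z), which becomes t + 1 + kappa / t, with
   kappa = 1 / (1 - lambda), in an affine coordinate t where c1, c2 are
   -1/s, 1/s.  The range of theta means |kappa| < 1.  For suitable alpha of
   modulus about p^2, the map f_alpha^2 has an attracting fixed point at a large
   real t = p and contracts the disc |t - p| <= p - 1 (nearly Re t >= 1) towards
   p.  The point 1/s is sent close to 1 + 2/s, of real part > 1, hence into this
   disc, so c2 is attracted by an attracting 2-cycle of f_alpha. *)

Local Notation normc := (@Normc.normc _).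

(** * Modulus of complex numbers *)

Section modulus.
Variable R : realType.
Implicit Types z w : R[i].

Lemma normc_ge0 z : 0 <= normc z.
Proof. by case: z => a b; exact: sqrtr_ge0. Qed.

Lemma normc_eq0 z : (normc z == 0) = (z == 0).
Proof.
by apply/eqP/eqP => [/Normc.eq0_normc//|->]; exact: Normc.normc0.
Qed.

Lemma normc_gt0 z : (0 < normc z) = (z != 0).
Proof. by rewrite lt_def normc_ge0 andbT normc_eq0. Qed.

Lemma ler_normcD z w : normc (z + w) <= normc z + normc w.
Proof. exact: le_normcD. Qed.

Lemma normc_opp z : normc (- z) = normc z.
Proof. exact: normcN. Qed.

Lemma normc_sub z w : normc (z - w) = normc (w - z).
Proof. by rewrite -normc_opp opprB. Qed.

Lemma ler_normcB z w : normc (z - w) <= normc z + normc w.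
Proof. by rewrite -(normc_opp w); exact: ler_normcD. Qed.

Lemma lerB_normcD z w : normc z - normc w <= normc (z + w).
Proof. by rewrite lerBlDr -{1}(addrK w z); exact: ler_normcB. Qed.

Lemma normc_div z w : normc (z / w) = normc z / normc w.
Proof. by rewrite Normc.normcM Normc.normcV. Qed.

Lemma sqr_normcE z : normc z ^+ 2 = complex.Re z ^+ 2 + complex.Im z ^+ 2.
Proof. by case: z => a b /=; rewrite sqr_sqrtr // addr_ge0 ?sqr_ge0. Qed.

Lemma Re_le_normc z : `|complex.Re z| <= normc z.
Proof.
rewrite -(@ler_pXn2r _ 2) ?nnegrE ?normc_ge0 // sqr_normcE.
by rewrite real_normK ?num_real // lerDl sqr_ge0.
Qed.

Lemma normc_real (x : R) : normc x%:C = `|x|.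
Proof. by rewrite /= expr0n addr0 sqrtr_sqr. Qed.

End modulus.

(** * Discs and continuity in the complex plane *)

Section plane_topology.
Variable R : realType.
Implicit Types (z w : R[i]^o) (r : R).

(** The norm of [R[i]^o] takes its values in [R[i]], where a positive radius has zero imaginary
    part. Neighbourhoods can thus be handled with real radii. *)
Lemma nbhs_discP z (A : set R[i]^o) :
  nbhs z A <-> exists2 r, 0 < r & forall w, normc (w - z) < r -> A w.
Proof.
split=> [/nbhs_normP[e /= e0 eA]|[r r0 rA]].
- move: e0 eA; case: e => a b; rewrite ltcE /= => /andP[/eqP -> a0] eA.
  exists a => // w wz; apply: eA => /=.
  by rewrite normc_sub in wz; rewrite ltcE /= eqxx.
- apply/(@nbhs_normP _ R[i]^o z A); exists r%:C => /=.
    by rewrite ltcE /= eqxx.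
  move=> w /=; rewrite ltcE /= => /andP[_ wz]; apply: rA.
  by rewrite normc_sub.
Qed.

Lemma disc_open z r : open [set w : R[i]^o | normc (w - z) < r].
Proof.
rewrite openE => w /= wr; apply/nbhs_discP; exists (r - normc (w - z)).
  by rewrite subr_gt0.
move=> u; rewrite ltrBrDr; apply: le_lt_trans.
by have := ler_normcD (u - w) (w - z); rewrite addrA subrK.
Qed.

(** The disc is the union of the segments that join its centre to its points, each a continuous
    image of [0, 1]. *)
Lemma disc_connected z r : connected [set w : R[i]^o | normc (w - z) < r].
Proof.
pose seg w := [set (z + t%:C * (w - z) : R[i]^o) | t in `[0, 1 : R]].
have [r0|r0] := ltP 0 r; last first.
  rewrite (_ : [set w | _] = set0); first exact: connected0.
  by rewrite -subset0 => w /= /lt_le_trans/(_ r0); rewrite ltNge normc_ge0.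
rewrite (_ : [set w | _] = \bigcup_(w in [set w | normc (w - z) < r]) seg w).
  apply: bigcup_connected.
    exists z => w _; exists 0; first by rewrite /= in_itv /= lexx ler01.
    by rewrite mul0r addr0.
  move=> w _; apply: connected_continuous_connected.
    exact: segment_connected.
  apply: continuous_subspaceT => t A /nbhs_discP[e e0 eA].
  apply/nbhs_normP; exists (e / (normc (w - z) + 1)).
    by rewrite /= divr_gt0 // ltr_wpDl ?normc_ge0.
  move=> u /= tu; apply: eA.
  rewrite (_ : _ - _ = (u - t)%:C * (w - z)); last by rewrite rmorphB; ring.
  rewrite Normc.normcM normc_real distrC.
  have n0 := normc_ge0 (w - z).
  rewrite (@le_lt_trans _ _ (`|t - u| * (normc (w - z) + 1))) //.
    by apply: ler_wpM2l => //; lra.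
  by rewrite -ltr_pdivlMr //; lra.
apply/seteqP; split=> w /=.
  move=> wr; exists w => //; exists 1; first by rewrite /= in_itv /= ler01 lexx.
  by rewrite rmorph1 mul1r addrC subrK.
move=> [v /= vr [t]]; rewrite /= in_itv /= => /andP[t0 t1] <-.
rewrite addrC addKr Normc.normcM normc_real ger0_norm //.
by apply: le_lt_trans vr; rewrite ler_piMl ?normc_ge0.
Qed.

Local Notation C := (R[i]^o).
Implicit Types f g : C -> C.

Lemma complex_continuousM f g z :
  {for z, continuous f} -> {for z, continuous g} ->
  {for z, continuous (fun x => f x * g x : C)}.
Proof.
by move=> cf cg; exact: (@cvgM R[i] _ _ (nbhs_filter z) f g _ _ cf cg).
Qed.

Lemma complex_continuousV f z : f z != 0 -> {for z, continuous f} ->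
  {for z, continuous (fun x => (f x)^-1 : C)}.
Proof. by move=> f0 cf; exact: (@cvgV R[i] _ _ (nbhs_filter z) f _ f0 cf). Qed.

Lemma complex_continuousD f g z :
  {for z, continuous f} -> {for z, continuous g} ->
  {for z, continuous (fun x => f x + g x : C)}.
Proof.
by move=> cf cg; exact: (@cvgD _ _ _ _ (nbhs_filter z) f g _ _ cf cg).
Qed.

Lemma complex_continuousB f g z :
  {for z, continuous f} -> {for z, continuous g} ->
  {for z, continuous (fun x => f x - g x : C)}.
Proof.
by move=> cf cg; exact: (@cvgB _ _ _ _ (nbhs_filter z) f g _ _ cf cg).
Qed.

Lemma complex_continuous_id z : {for z, continuous (fun x : C => x)}.
Proof. exact: cvg_id. Qed.

Lemma near_neq0 f z : {for z, continuous f} -> f z != 0 ->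
  \forall x \near z, f x != 0.
Proof.
move=> cf fz0; apply: (cf [set w | w != 0]); apply/nbhs_discP.
exists (normc (f z)); first by rewrite normc_gt0.
by move=> w; apply: contraTneq => ->; rewrite sub0r normc_opp ltxx.
Qed.

Lemma near_disc f z (c : C) r : {for z, continuous f} -> normc (f z - c) < r ->
  \forall x \near z, normc (f x - c) < r.
Proof.
move=> cf fzr; apply: (cf [set w | normc (w - c) < r]).
by apply: open_nbhs_nbhs; split => //; exact: disc_open.
Qed.

End plane_topology.

(** * Fatou components and attracted open sets *)

Section fatou_set.
Variable R : realType.
Implicit Types (f : sphere R -> sphere R) (p : sphere R) (U : set (sphere R)).

Lemma chordal_Some (z w : R[i]) :
  chordal (Some z) (Some w) <= 2 * normc (z - w).
Proof.
rewrite /chordal ler_pdivrMr; last first.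
  by rewrite sqrtr_gt0 mulr_gt0 // ltr_wpDr ?sqr_ge0.
rewrite ler_peMr ?mulr_ge0 ?normc_ge0 //.
rewrite -{1}sqrtr1 ler_sqrt ?mulr_ge0 ?addr_ge0 ?sqr_ge0 //.
by rewrite -[leLHS]mulr1 ler_pM ?ler01 // lerDl sqr_ge0.
Qed.

Lemma chordal_refl p : chordal p p = 0.
Proof. by case: p => [z|] //=; rewrite subrr Normc.normc0 mulr0 mul0r. Qed.

Lemma open_nbhs_fatou f p U :
  open U -> U p -> normal_family U (range (fun n => iter n f)) ->
  nbhs p (Defs.fatou f).
Proof.
move=> oU Up nU; apply: filterS (open_nbhs_nbhs (conj oU Up)) => q Uq.
by exists U.
Qed.

(** The Fatou set is open, so it contains a disc around z. If z is in the closure of the component,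
    this connected disc meets the component, hence lies in it, and z is an interior point. *)
Lemma fatou_not_boundary f p (z : R[i]) :
  Defs.fatou f (Some z) -> ~ boundary (fatou_component f p) (Some z).
Proof.
move=> [U [oU Uz nU]] [clz]; apply.
have /nbhs_discP[r r0 rU] := open_nbhs_fatou oU Uz nU.
set D := [set w : R[i]^o | normc (w - z) < r].
have nD : nbhs (z : R[i]^o) D by apply/nbhs_discP; exists r.
have nSD := one_point_compactification_some_nbhs _ _ nD.
have [q [Cq Dq]] := clz _ nSD.
apply: filterS nSD; rewrite /fatou_component.
rewrite (same_connected_component Cq).
apply: (connected_component_max Dq).
  by move=> _ [w Dw <-]; exact: rU.
apply: connected_continuous_connected; first exact: disc_connected.
apply: continuous_subspaceT.
exact: one_point_compactification_some_continuous.
Qed.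

Lemma infinitely_often_subseq (P : nat -> Prop) :
  (forall N, exists2 n, (N <= n)%N & P n) ->
  exists2 phi : nat -> nat,
    {homo phi : m n / (m < n)%N} & forall n, P (phi n).
Proof.
move=> infP; pose h N := sval (cid2 (infP N)).
have hP N : (N <= h N)%N /\ P (h N) by rewrite /h; case: cid2.
exists (fun n => iter n (h \o succn) (h 0)).
  apply: homo_ltn => [m n p|n]; first exact: ltn_trans.
  by rewrite iterS; exact: (hP _).1.
by case=> [|n]; [exact: (hP _).2|rewrite iterS; exact: (hP _).2].
Qed.

(** [l] gives the limits along even and odd times, as for attraction to a 2-cycle. Let u n be the
    iterate of order k n. If k takes some value infinitely often, a subsequence of u is constant.
    Otherwise k tends to infinity, one parity b occurs infinitely often, and the corresponding
    subsequence converges uniformly on U to the constant [l b]. *)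
Lemma attracted_fatou f U p (l : bool -> sphere R) : open U -> U p ->
  (forall e : R, 0 < e -> \forall m \near \oo, forall q, U q ->
     chordal (iter m f q) (l (odd m)) < e) ->
  Defs.fatou f p.
Proof.
move=> oU Up fl; exists U; split=> // u uP.
pose k n := sval (cid2 (uP n)).
have uE n : u n = iter (k n) f by rewrite /k; case: cid2.
have [[m infm]|/forallNP finm] :=
    pselect (exists m, forall N, exists2 n, (N <= n)%N & k n = m).
  have [phi phi_incr phiE] := infinitely_often_subseq infm.
  exists phi, (iter m f); split=> // q Uq; exists U.
  split; first exact: open_nbhs_nbhs.
  by move=> e e0; near=> n => x _; rewrite uE phiE chordal_refl.
have k_oo m : exists N, forall n, (N <= n)%N -> (m <= k n)%N.
  elim: m => [|m [N kN]]; first by exists 0.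
  have /existsNP[N' N'P] := finm m; exists (maxn N N') => n.
  rewrite geq_max => /andP[Nn N'n]; rewrite ltn_neqAle kN // andbT.
  by apply/eqP => mk; apply: N'P; exists n.
have [b infb] : exists b, forall N, exists2 n, (N <= n)%N & odd (k n) = b.
  have [|/existsNP[N NP]] :=
    pselect (forall N, exists2 n, (N <= n)%N & odd (k n) = true).
    by exists true.
  exists false => N'; exists (maxn N N'); first exact: leq_maxr.
  by apply/negbTE/negP => kb; apply: NP; exists (maxn N N');
    rewrite ?leq_maxl.
have [phi phi_incr phib] := infinitely_often_subseq infb.
exists phi, (fun=> l b); split=> // q Uq; exists U.
split; first exact: open_nbhs_nbhs.
move=> e /fl[M _ fM]; have [N kN] := k_oo M.
exists N => // n /= Nn x Ux; rewrite uE -(phib n); apply: fM => //=.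
apply: kN; apply: leq_trans Nn _.
elim: n => // n IH; exact: leq_ltn_trans IH (phi_incr _ _ (ltnSn n)).
Unshelve. all: by end_near. Qed.

End fatou_set.

(** * The second iterate in the coordinate t, and its expansion in 1 / p *)

Section renormalized_map.
Variable R : realType.
Variables (kap b : R[i]) (p : R).
Implicit Type t : R[i].

Let pc : R[i] := p%:C.

(* With b = 1 - 1 / lambda, kap = 1 / (1 - lambda) and z = b (t + kap), the map
   f_alpha sends z to 1 / (beta Y) and then to b (Phi t + kap), where Y = Ymap t
   and alpha = b / (lambda beta).  The value of beta solves Phi p = p. *)
Definition Ymap t := t + kap + 1 + kap / t.
(** The value that beta b Y / (1 + beta Y) must take at Y = [Ymap pc] for p to be fixed by [Phi];
    solving for beta gives the next formula. *)
Definition Xfix := (1 + kap / pc) / Ymap pc.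
Definition beta := Xfix / (Ymap pc * (b - Xfix)).
(** Divided difference of Y |-> beta b Y^2 / (1 + beta Y) between [Ymap pc] and [Ymap t], simplified
    by the equation for beta. *)
Definition Dmap t := (Xfix + beta * b * Ymap t) / (1 + beta * Ymap t).
Definition Phi t :=
  Ymap t - beta * b * Ymap t ^+ 2 / (1 + beta * Ymap t) - kap.

(** [Phi] is a function of [Ymap t], so its divided difference is a product: 1 - kap / (p t) comes
    from [Ymap], and 1 - [Dmap t] from the outer function. *)
Lemma Phi_sub_fix t : p != 0 -> t != 0 -> Ymap pc != 0 -> b != Xfix ->
  1 + beta * Ymap t != 0 ->
  Phi t - pc = (t - pc) * ((1 - kap / (pc * t)) * (1 - Dmap t)).
Proof.
move=> p0 t0 Yp0 bX dt0.
have pc0 : pc != 0 by rewrite -normc_eq0 normc_real normr_eq0.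
have bX0 : b - Xfix != 0 by rewrite subr_eq0.
have dY : Ymap t - Ymap pc = (t - pc) * (1 - kap / (pc * t)).
  by rewrite /Ymap; field; rewrite t0 pc0.
have pE : pc = Ymap pc - kap - Xfix * Ymap pc.
  by rewrite /Xfix divfK // /Ymap; ring.
have betaE : beta * Ymap pc * (b - Xfix) = Xfix.
  by rewrite /beta; field; rewrite Yp0 bX0.
rewrite mulrA -dY {1}pE /Phi /Dmap.
apply: (mulIf dt0).
transitivity ((Ymap t - Ymap pc) *
    (1 + beta * Ymap t - (Xfix + beta * b * Ymap t))); last first.
  by field.
move: (Ymap pc) (Xfix) (beta) (Ymap t) dt0 betaE => yp x be y dt0 betaE.
transitivity ((y - kap - (yp - kap - x * yp)) * (1 + be * y) - be * b * y ^+ 2).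
  by field.
apply/eqP; rewrite -subr_eq0; apply/eqP.
transitivity (y * (x - be * yp * (b - x))); first by ring.
by rewrite betaE subrr mulr0.
Qed.

Hypotheses (kap1 : normc kap < 1) (b1 : 1 <= normc b) (p_ge : 100 <= p).
(** The small parameter: the estimates below are expansions in powers of h with explicit
    constants. *)
Let h : R := p^-1.

Let h_gt0 : 0 < h. Proof. by rewrite invr_gt0; move: p_ge; lra. Qed.
Let hp : h * p = 1. Proof. by rewrite mulVf //; apply/eqP; move: p_ge; lra. Qed.
Let h_le : h <= 1 / 100.
Proof. by rewrite -(ler_pM2r (x := p)) ?hp; move: p_ge; lra. Qed.

Let pc_neq0 : pc != 0.
Proof. by rewrite -normc_gt0 normc_real gtr0_norm; move: p_ge; lra. Qed.

Let normc_pc : normc pc = p.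
Proof. by rewrite normc_real ger0_norm; move: p_ge; lra. Qed.

Let pcV : pc^-1 = h%:C. Proof. by rewrite /pc /h fmorphV. Qed.

Let normcM_le (z w : R[i]) (x y : R) :
  normc z <= x -> normc w <= y -> normc (z * w) <= x * y.
Proof. by move=> zx wy; rewrite Normc.normcM ler_pM ?normc_ge0. Qed.

Let normcD_le (z w : R[i]) (x y : R) :
  normc z <= x -> normc w <= y -> normc (z + w) <= x + y.
Proof. by move=> zx wy; apply: le_trans (ler_normcD _ _) _; rewrite lerD. Qed.

Let normc_hc : normc h%:C = h.
Proof. by rewrite normc_real ger0_norm // ltW. Qed.

Let kap_pc : normc (kap / pc) <= h.
Proof.
by rewrite pcV -[leRHS]mul1r; apply: normcM_le; rewrite ?normc_hc // ltW.
Qed.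

Let Ymap_pc_sub : normc (Ymap pc - pc) <= 3.
Proof.
have -> : Ymap pc - pc = kap + 1 + kap / pc by rewrite /Ymap; ring.
apply: (@le_trans _ _ (1 + 1 + h)); last by move: h_le; lra.
by do 2!apply: normcD_le => //; rewrite ?Normc.normc1 // ltW.
Qed.

Let Ymap_pc_ge : p / 2 <= normc (Ymap pc).
Proof.
have := lerB_normcD pc (Ymap pc - pc); rewrite addrCA subrr addr0 normc_pc.
by move: Ymap_pc_sub p_ge; lra.
Qed.

Lemma Ymap_pc_neq0 : Ymap pc != 0.
Proof. by rewrite -normc_gt0; move: Ymap_pc_ge p_ge; lra. Qed.

Let YmapV_pc : normc (Ymap pc)^-1 <= 2 * h.
Proof.
rewrite Normc.normcV -(ler_pM2r (x := normc (Ymap pc))); last first.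
  by move: Ymap_pc_ge p_ge; lra.
rewrite mulVf; last by move: Ymap_pc_neq0; rewrite -normc_eq0.
by move: Ymap_pc_ge (hp) h_gt0; nra.
Qed.

Let Xfix_le : normc Xfix <= 3 * h.
Proof.
apply: (@le_trans _ _ ((1 + h) * (2 * h))); last by move: h_gt0 h_le; nra.
by apply: normcM_le => //; apply: normcD_le; rewrite ?Normc.normc1.
Qed.

(** Since p + kap - [Ymap pc] = -(1 + kap / p), the difference is exactly -[Xfix] / p. *)
Let Xfix_sub : normc (Xfix - h%:C) <= 3 * h ^+ 2.
Proof.
have -> : Xfix - h%:C = - (Xfix / pc).
  have Yp0 := Ymap_pc_neq0.
  transitivity ((pc + kap - Ymap pc) / pc / Ymap pc).
    by rewrite -pcV /Xfix; field; rewrite Yp0 pc_neq0.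
  have -> : pc + kap - Ymap pc = - (1 + kap / pc) by rewrite /Ymap; ring.
  by rewrite /Xfix; field; rewrite Yp0 pc_neq0.
rewrite normc_opp pcV expr2 mulrA.
by apply: normcM_le => //; rewrite normc_hc.
Qed.

Let b_sub_Xfix : 1 / 2 <= normc (b - Xfix).
Proof.
have := lerB_normcD b (- Xfix); rewrite normc_opp.
by move: Xfix_le b1 h_le; lra.
Qed.

Lemma b_neq_Xfix : b != Xfix.
Proof. by rewrite -subr_eq0 -normc_gt0; move: b_sub_Xfix; lra. Qed.

Let b_sub_XfixV : normc (b - Xfix)^-1 <= 2.
Proof.
rewrite Normc.normcV -[leRHS]invrK lef_pV2 ?posrE ?invr_gt0 //;
  by move: b_sub_Xfix; lra.
Qed.

(** As |alpha| = |b| / |beta| when |lambda| = 1, this bound is what makes |alpha| large. *)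
Lemma beta_le : normc beta <= 12 * h ^+ 2.
Proof.
have -> : 12 * h ^+ 2 = 3 * h * (2 * h * 2) by ring.
by apply: normcM_le => //; rewrite invfM; apply: normcM_le.
Qed.

(** The three error terms come from replacing by 1, h and h in turn the factors b / (b - [Xfix]),
    [Xfix] and 1 / [Ymap pc] of beta b. *)
Let beta_b_sub : normc (beta * b - (h ^+ 2)%:C) <= 48 * h ^+ 3.
Proof.
have -> : beta * b - (h ^+ 2)%:C =
    Xfix * (Ymap pc)^-1 * (Xfix * (b - Xfix)^-1) +
    (Xfix - h%:C) * (Ymap pc)^-1 +
    h%:C * (h%:C * (Ymap pc)^-1 * (pc - Ymap pc)).
  have hpc : h%:C * pc = 1 by rewrite -pcV mulVf.
  have -> : h%:C * (h%:C * (Ymap pc)^-1 * (pc - Ymap pc)) =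
      h%:C * (h%:C * pc) * (Ymap pc)^-1 - h%:C * h%:C.
    by field; exact: Ymap_pc_neq0.
  rewrite hpc rmorphXn /beta; field.
  by rewrite Ymap_pc_neq0 subr_eq0 b_neq_Xfix.
have -> : 48 * h ^+ 3 = 3 * h * (2 * h) * (3 * h * 2) +
   3 * h ^+ 2 * (2 * h) + h * (h * (2 * h) * 3) by ring.
apply: normcD_le; first apply: normcD_le.
- by do 2!apply: normcM_le.
- exact: normcM_le.
- by do 3?apply: normcM_le; rewrite ?normc_hc // normc_sub.
Qed.

Lemma beta_b_le : normc (beta * b) <= 2 * h ^+ 2.
Proof.
rewrite -(subrK (h ^+ 2)%:C (beta * b)).
apply: (@le_trans _ _ (48 * h ^+ 3 + h ^+ 2)).
  by apply: normcD_le => //; rewrite normc_real ger0_norm // sqr_ge0.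
by rewrite exprS; move: h_le (sqr_ge0 h); nra.
Qed.

(** * Contraction on the disc |t - p| <= p - 1 *)

Section disc.
Variable t : R[i].
Hypothesis tp : normc (t - pc) <= p - 1.

Lemma disc_Re_ge1 : 1 <= complex.Re t.
Proof.
have := Re_le_normc (t - pc); rewrite raddfB /= => /le_trans/(_ tp).
by rewrite ler_norml; lra.
Qed.

Let t_ge1 : 1 <= normc t.
Proof.
by apply: le_trans disc_Re_ge1 (le_trans (ler_norm _) (Re_le_normc _)).
Qed.

Lemma disc_neq0 : t != 0.
Proof. by rewrite -normc_gt0; move: t_ge1; lra. Qed.

Let tV_le : normc t^-1 <= 1.
Proof. by rewrite Normc.normcV invf_le1 //; move: t_ge1; lra. Qed.

Let kap_t : normc (kap / t) <= normc kap.
Proof. by rewrite -[leRHS]mulr1; apply: normcM_le. Qed.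

Let t_le : normc t <= 2 * p.
Proof.
rewrite -(subrK pc t); apply: le_trans (normcD_le tp (lexx _)) _.
by rewrite normc_pc; move: p_ge; lra.
Qed.

Lemma disc_Ymap_le : normc (Ymap t) <= 3 * p.
Proof.
apply: (@le_trans _ _ (2 * p + 1 + 1 + 1)); last by move: p_ge; lra.
do 3?apply: normcD_le; rewrite ?Normc.normc1 // ?ltW //.
exact: le_lt_trans kap_t _.
Qed.

(** Here Re t >= 1 and |1 / t| <= 1, so kap and kap / t each cost at most |kap|. As |kap| < 1 the
    bound is positive: [Ymap] has no zero in the disc, and Re w >= h below. *)
Lemma disc_Re_Ymap : 2 * (1 - normc kap) <= complex.Re (Ymap t).
Proof.
have := disc_Re_ge1; have := Re_le_normc kap.
have := le_trans (Re_le_normc (kap / t)) kap_t.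
rewrite !ler_norml /Ymap !raddfD /=; lra.
Qed.

Let beta_Y : normc (beta * Ymap t) <= 36 * h.
Proof.
apply: le_trans (normcM_le beta_le disc_Ymap_le) _.
have -> : 12 * h ^+ 2 * (3 * p) = 36 * h * (h * p) by ring.
by rewrite hp mulr1.
Qed.

Let beta_Y1 : 1 / 2 <= normc (1 + beta * Ymap t).
Proof.
have := lerB_normcD 1 (beta * Ymap t); rewrite Normc.normc1.
by move: beta_Y h_le; lra.
Qed.

Lemma disc_denom_neq0 : 1 + beta * Ymap t != 0.
Proof. by rewrite -normc_gt0; move: beta_Y1; lra. Qed.

(* First-order value of [Dmap t]: since [Re w >= h], the factor [1 - Dmap t]
   contracts by about [1 - h], which beats the expansion [1 + normc kap * h] of
   the other factor in [Phi_sub_fix]. *)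
Let w := h%:C + (h ^+ 2)%:C * Ymap t.

Let Re_w : h <= complex.Re w.
Proof.
rewrite /w raddfD /= -[leLHS]addr0 lerD2l.
case: (Ymap t) disc_Re_Ymap => u v /= uk; rewrite mul0r subr0.
by rewrite mulr_ge0 ?sqr_ge0 //; move: uk kap1; lra.
Qed.

Let w_le : normc w <= 4 * h.
Proof.
apply: (@le_trans _ _ (h + h ^+ 2 * (3 * p))).
  apply: normcD_le; first by rewrite normc_hc.
  by apply: normcM_le; rewrite ?disc_Ymap_le // normc_real ger0_norm ?sqr_ge0.
have -> : h ^+ 2 * (3 * p) = 3 * h * (h * p) by ring.
by rewrite hp; lra.
Qed.

(** |1 - w|^2 = 1 - 2 Re w + |w|^2 <= 1 - 2 h + 16 h^2, which is (1 - h + 8 h^2)^2 minus the square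
    of h - 8 h^2. *)
Let one_sub_w : normc (1 - w) <= 1 - h + 8 * h ^+ 2.
Proof.
have r0 : 0 <= 1 - h + 8 * h ^+ 2 by move: h_le (sqr_ge0 h); lra.
have : normc (1 - w) ^+ 2 <= (1 - h + 8 * h ^+ 2) ^+ 2; last first.
  by rewrite ler_pXn2r // nnegrE normc_ge0.
have : normc w ^+ 2 <= (4 * h) ^+ 2.
  by rewrite ler_pXn2r // nnegrE ?normc_ge0 // mulr_ge0 // ltW.
rewrite !sqr_normcE; case: w Re_w => u v /= uh.
by move=> uv; have := sqr_ge0 (h - 8 * h ^+ 2); lra.
Qed.

(** The numerator E of [Dmap t] is w up to 147 h^2, and dividing by 1 + beta Y changes it by beta Y
    [Dmap t], at most 36 h times 12 h. *)
Let Dmap_sub : normc (Dmap t - w) <= 579 * h ^+ 2.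
Proof.
set E := Xfix + beta * b * Ymap t.
have Ew : normc (E - w) <= 147 * h ^+ 2.
  have -> : E - w = (Xfix - h%:C) + (beta * b - (h ^+ 2)%:C) * Ymap t.
    by rewrite /E /w; ring.
  apply: le_trans (normcD_le Xfix_sub (normcM_le beta_b_sub disc_Ymap_le)) _.
  have -> : 48 * h ^+ 3 * (3 * p) = 144 * h ^+ 2 * (h * p) by ring.
  by rewrite hp mulr1; lra.
have E_le : normc E <= 6 * h.
  rewrite -(subrK w E); apply: le_trans (normcD_le Ew w_le) _.
  by move: h_gt0 h_le; nra.
have D_le : normc (Dmap t) <= 12 * h.
  have -> : 12 * h = 6 * h * 2 by ring.
  apply: normcM_le => //.
  rewrite Normc.normcV -[leRHS]invrK lef_pV2 ?posrE ?invr_gt0 //;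
    by move: beta_Y1; lra.
have -> : Dmap t - w = (E - w) - beta * Ymap t * Dmap t.
  by rewrite /Dmap -/E; field; exact: disc_denom_neq0.
apply: (@le_trans _ _ (147 * h ^+ 2 + 36 * h * (12 * h))); last by lra.
by apply: normcD_le => //; rewrite normc_opp; exact: normcM_le.
Qed.

(** The two factors of [Phi_sub_fix] are at most 1 + |kap| h and 1 - h + 587 h^2. Their product is
    below 1 once p is large compared with 1 / (1 - |kap|). *)
Lemma disc_Phi_sub :
  normc (Phi t - pc) <=
  normc (t - pc) * (1 - (1 - normc kap) * h + 1200 * h ^+ 2).
Proof.
rewrite Phi_sub_fix ?Ymap_pc_neq0 ?b_neq_Xfix ?disc_denom_neq0 ?disc_neq0 //;
  last first.
  by apply/eqP; move: p_ge; lra.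
apply: normcM_le => //.
have D1 : normc (1 - Dmap t) <= 1 - h + 587 * h ^+ 2.
  have -> : 1 - Dmap t = (1 - w) - (Dmap t - w) by ring.
  apply: le_trans (normcD_le one_sub_w (_ : _ <= 579 * h ^+ 2)) _.
    by rewrite normc_opp.
  by lra.
have k1 : normc (1 - kap / (pc * t)) <= 1 + h * normc kap.
  apply: normcD_le; first by rewrite Normc.normc1.
  rewrite normc_opp invfM mulrCA pcV; apply: normcM_le => //.
  by rewrite normc_hc.
apply: le_trans (normcM_le k1 D1) _.
have k0 := normc_ge0 kap.
have h2 := sqr_ge0 h.
have : h * normc kap * h ^+ 2 <= h ^+ 2.
  by rewrite ler_piMl //; move: h_gt0 h_le kap1; nra.
have : 0 <= h ^+ 2 * normc kap by rewrite mulr_ge0.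
by lra.
Qed.

End disc.

(** As v is a critical point of t + 1 + kap / t, [Ymap v] = (1 + v)^2 and [Phi v] is 1 + 2 v up to
    64 h^2. The point 1 + 2 v lies in the disc at depth at least Re v, more than this error. *)
Lemma first_step (v : R[i]) : kap = v ^+ 2 -> 0 < complex.Re v ->
  2 <= complex.Re v * (p - 1) ->
  [/\ Ymap v != 0, 1 + beta * Ymap v != 0 & normc (Phi v - pc) < p - 1].
Proof.
move=> kapv v0 vp.
have v_neq0 : v != 0 by apply: contraTneq v0 => ->; rewrite ltxx.
have v1 : normc v <= 1.
  have := kap1; rewrite kapv Normc.normcM -expr2 => /ltW.
  by rewrite expr_le1 ?normc_ge0.
have YE : Ymap v = (1 + v) ^+ 2 by rewrite /Ymap kapv; field.
have Y0 : Ymap v != 0.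
  rewrite YE sqrf_eq0; apply: contraTneq v0 => v1N.
  have -> : v = -1 by apply/eqP; rewrite -subr_eq0 opprK addrC v1N.
  by rewrite raddfN /= oppr_gt0 ltr10.
have Y4 : normc (Ymap v) <= 4.
  rewrite YE expr2 (_ : 4 = (1 + 1) * (1 + 1)); last by ring.
  by apply: normcM_le; apply: normcD_le; rewrite ?Normc.normc1.
have bY1 : 1 / 2 <= normc (1 + beta * Ymap v).
  have := lerB_normcD 1 (beta * Ymap v); rewrite Normc.normc1.
  have := normcM_le beta_le Y4; move: h_gt0 h_le; nra.
have bY0 : 1 + beta * Ymap v != 0 by rewrite -normc_gt0; move: bY1; lra.
split=> //.
have -> : Phi v - pc = (1 + 2 * v - pc) -
    beta * b * (Ymap v * Ymap v) * (1 + beta * Ymap v)^-1.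
  have YE' : Ymap v = 1 + 2 * v + kap by rewrite YE kapv; ring.
  by rewrite /Phi expr2 {1}YE'; ring.
have N1 : normc (beta * b * (Ymap v * Ymap v) * (1 + beta * Ymap v)^-1) <=
    2 * h ^+ 2 * (4 * 4) * 2.
  apply: normcM_le.
    by apply: normcM_le; [exact: beta_b_le|exact: normcM_le].
  rewrite Normc.normcV -[leRHS]invrK lef_pV2 ?posrE ?invr_gt0 //;
    by move: bY1; lra.
(* With v = a + i c, squaring reduces this to 3 a^2 + 4 c^2 <= 2 a (p - 1). The left side is at most
   4 because |v| <= 1, and the right side is at least 4 by hypothesis. *)
have N2 : normc (1 + 2 * v - pc) <= p - 1 - complex.Re v.
  have a1 : complex.Re v <= 1.
    exact: le_trans (ler_norm _) (le_trans (Re_le_normc _) v1).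
  have r0 : 0 <= p - 1 - complex.Re v by move: p_ge; lra.
  have : normc (1 + 2 * v - pc) ^+ 2 <= (p - 1 - complex.Re v) ^+ 2; last first.
    by rewrite ler_pXn2r // nnegrE normc_ge0.
  have : normc v ^+ 2 <= 1 by rewrite expr_le1 ?normc_ge0.
  rewrite !sqr_normcE; move: vp; rewrite /pc.
  move: (v) => [a c] /= ap ac; have := sqr_ge0 a; lra.
have ha : 64 * h ^+ 2 < complex.Re v.
  have : 2 * h < complex.Re v.
    rewrite -(ltr_pM2r (x := p)); last by move: p_ge; lra.
    by rewrite -mulrA hp; move: vp v0; nra.
  by move: h_gt0 h_le; nra.
apply: le_lt_trans (ler_normcB _ _) _.
by move: N1 N2 ha; lra.
Qed.

Lemma beta_neq0 : beta != 0.
Proof.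
have Yp0 := Ymap_pc_neq0; have bX := b_neq_Xfix.
have X0 : Xfix != 0; last first.
  by rewrite /beta mulf_neq0 // invr_eq0 mulf_neq0 // subr_eq0.
rewrite /Xfix mulf_neq0 ?invr_eq0 // -normc_gt0.
have := lerB_normcD 1 (kap / pc); rewrite Normc.normc1.
by move: kap_pc h_le; lra.
Qed.

(** * Return to f_alpha and attraction to its 2-cycle *)

Section conjugation.
Variable lam : R[i].
Hypotheses (lam0 : lam != 0) (lam1 : lam != 1).
Hypotheses (bE : b = (lam - 1) / lam) (kapE : kap = (1 - lam)^-1).
Let alpha := b / (lam * beta).
Let f := Defs.fmap lam alpha.

Let b_neq0 : b != 0.
Proof. by rewrite bE mulf_neq0 ?invr_eq0 // subr_eq0. Qed.

Let lam1' : 1 - lam != 0. Proof. by rewrite subr_eq0 eq_sym. Qed.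

(** For z = b (t + kap), z + z^2 = b^2 t [Ymap t] and 1 + lambda z = lambda b t, so t cancels in the
    quotient. *)
Lemma fmap_even t : t != 0 -> Ymap t != 0 ->
  f (Some (b * (t + kap))) = Some (beta * Ymap t)^-1.
Proof.
move=> t0 Yt0; rewrite /f /Defs.fmap.
have E1 : b * (t + kap) + (b * (t + kap)) ^+ 2 = b ^+ 2 * (t * Ymap t).
  by rewrite /Ymap bE kapE; field; rewrite t0 lam0 lam1'.
have E2 : 1 + lam * (b * (t + kap)) = lam * b * t.
  by rewrite bE kapE; field; rewrite lam0 lam1'.
rewrite E1 ifF; last by apply/negbTE; rewrite mulf_neq0 ?sqrf_eq0 // mulf_neq0.
rewrite E2 /alpha; congr Some; have be0 := beta_neq0; field.
by rewrite b_neq0 Yt0 be0 lam0 t0.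
Qed.

Lemma fmap_odd t : Ymap t != 0 -> 1 + beta * Ymap t != 0 ->
  f (Some (beta * Ymap t)^-1) = Some (b * (Phi t + kap)).
Proof.
move=> Yt0 bY; rewrite /f /Defs.fmap; have be0 := beta_neq0.
have E1 : (beta * Ymap t)^-1 + (beta * Ymap t)^-1 ^+ 2 =
    (1 + beta * Ymap t) / (beta * Ymap t) ^+ 2.
  by field; rewrite Yt0 be0.
rewrite E1 ifF; last first.
  by apply/negbTE; rewrite mulf_neq0 ?invr_eq0 ?sqrf_eq0 // mulf_neq0.
congr Some; rewrite /alpha /Phi subrK.
move: (Ymap t) (beta) Yt0 bY be0 => y be y0 by0 be0.
by rewrite bE; field; rewrite y0 by0 be0 lam0.
Qed.

Let Ymap_continuous t : t != 0 ->
  {for t : R[i]^o, continuous (Ymap : R[i]^o -> R[i]^o)}.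
Proof.
move=> t0; apply: complex_continuousD.
  by do 2![apply: complex_continuousD; last exact: cst_continuous].
apply: complex_continuousM; first exact: cst_continuous.
exact: complex_continuousV.
Qed.

Let Phi_continuous t : t != 0 -> 1 + beta * Ymap t != 0 ->
  {for t : R[i]^o, continuous (Phi : R[i]^o -> R[i]^o)}.
Proof.
move=> t0 bY0; have cY := Ymap_continuous t0.
apply: complex_continuousB; last exact: cst_continuous.
apply: complex_continuousB; first exact: cY.
apply: complex_continuousM.
  apply: complex_continuousM; first exact: cst_continuous.
  exact: (complex_continuousM cY cY).
apply: complex_continuousV; first exact: bY0.
apply: complex_continuousD; first exact: cst_continuous.
by apply: complex_continuousM; [exact: cst_continuous|exact: cY].
Qed.

Let tau (z : R[i]^o) : R[i]^o := z / b - kap.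

Let tau_continuous z : {for z, continuous tau}.
Proof.
apply: complex_continuousB; last exact: cst_continuous.
by apply: complex_continuousM; last exact: cst_continuous.
Qed.

Let q := 1 - (1 - normc kap) * h + 1200 * h ^+ 2.

Let q_ge0 : 0 <= q.
Proof.
have := normc_ge0 kap; have := sqr_ge0 h.
by rewrite /q; move: h_gt0 h_le kap1; nra.
Qed.

(** By continuity, two steps of f send a whole neighbourhood of the point into the contracted disc.
    From there the even iterates converge geometrically to one point of the cycle, the odd ones to
    the other, so [attracted_fatou] applies. *)
Lemma fatou_attracted_2cycle t : t != 0 -> Ymap t != 0 ->
  1 + beta * Ymap t != 0 -> normc (Phi t - pc) < p - 1 ->
  1200 < (1 - normc kap) * p ->
  Defs.fatou f (Some (b * (t + kap))).
Proof.
move=> t0 Yt0 bYt0 Pt pbig.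
have q1 : q < 1.
  have : 1200 * h < 1 - normc kap.
    rewrite -(ltr_pM2r (x := p)); last by move: p_ge; lra.
    by rewrite -mulrA hp mulr1.
  by rewrite /q; move: h_gt0; nra.
have tauK (u : R[i]) : tau (b * (u + kap)) = u.
  by rewrite /tau; field.
have tauE (z : R[i]) : z = b * (tau z + kap) by rewrite /tau; field.
pose z0 : R[i]^o := b * (t + kap).
have Y_disc u : normc (u - pc) <= p - 1 -> Ymap u != 0.
  move=> up; apply: contraTneq (disc_Re_Ymap up) => -> /=.
  by rewrite -ltNge; move: kap1; lra.
have iterPhi n u : normc (u - pc) <= p - 1 ->
    normc (iter n Phi u - pc) <= q ^+ n * normc (u - pc) /\
    normc (iter n Phi u - pc) <= p - 1.
  move=> up; have : normc (iter n Phi u - pc) <= q ^+ n * normc (u - pc).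
    elim: n => [|n IH]; first by rewrite mul1r.
    have qn1 : q ^+ n <= 1 by rewrite exprn_ile1 // ltW.
    have IHp : normc (iter n Phi u - pc) <= p - 1.
      by apply: le_trans IH (le_trans _ up); rewrite ler_piMl ?normc_ge0.
    rewrite iterS exprS -mulrA [q * _]mulrC.
    by apply: le_trans (disc_Phi_sub IHp) _; rewrite ler_wpM2r.
  move=> H; split=> //; apply: le_trans H (le_trans _ up).
  by rewrite ler_piMl ?normc_ge0 // exprn_ile1 // ltW.
have iterf n u : normc (u - pc) <= p - 1 ->
    iter n.*2 f (Some (b * (u + kap))) = Some (b * (iter n Phi u + kap)).
  move=> up; elim: n => [//|n IH].
  have [_ up'] := iterPhi n u up.
  rewrite doubleS !iterS IH fmap_even ?fmap_odd ?Y_disc ?(disc_neq0 up') //.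
  exact: disc_denom_neq0.
pose l (odd_time : bool) : sphere R :=
  if odd_time then Some (beta * Ymap pc)^-1 else Some (b * (pc + kap)).
(* A common Lipschitz bound, for both parities, of the chordal distance to the cycle in terms of |u
   - p|. The first summand serves even times. In the second, 2 bounds |1 - kap / (p u)| and the last
   factor bounds 1 / |[Ymap u]|. *)
pose C := 2 * (normc b +
  2 * ((normc (beta * Ymap pc))^-1 * (2 * (1 - normc kap))^-1)).
have C0 : 0 < C.
  have : 0 <= (normc (beta * Ymap pc))^-1 * (2 * (1 - normc kap))^-1.
    by rewrite mulr_ge0 ?invr_ge0 ?normc_ge0 // mulr_ge0 // subr_ge0 ltW.
  by rewrite /C; move: b1; lra.
have chordal_l c u : normc (u - pc) <= p - 1 ->
    chordal (iter (nat_of_bool c) f (Some (b * (u + kap)))) (l c) <=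
    C * normc (u - pc).
  move=> up; have n0 := normc_ge0 (u - pc).
  have C1 : 0 <= (normc (beta * Ymap pc))^-1 * (2 * (1 - normc kap))^-1.
    by rewrite mulr_ge0 ?invr_ge0 ?normc_ge0 // mulr_ge0 // subr_ge0 ltW.
  case: c; last first.
    apply: le_trans (chordal_Some _ _) _.
    have -> : b * (u + kap) - b * (pc + kap) = b * (u - pc) by ring.
    rewrite Normc.normcM /C -mulrA ler_pM2l // ler_wpM2r //; move: C1; lra.
  change (chordal (f (Some (b * (u + kap)))) (Some (beta * Ymap pc)^-1) <=
          C * normc (u - pc)).
  rewrite fmap_even ?Y_disc ?(disc_neq0 up) //.
  apply: le_trans (chordal_Some _ _) _; rewrite /C -mulrA ler_pM2l //.
  have Yp0 := Ymap_pc_neq0; have Yu0 := Y_disc u up; have be0 := beta_neq0.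
  have u0 := disc_neq0 up.
  have -> : (beta * Ymap u)^-1 - (beta * Ymap pc)^-1 =
      (1 - kap / (pc * u)) * ((beta * Ymap pc)^-1 * (Ymap u)^-1) * (pc - u).
    have E : Ymap pc - Ymap u = (pc - u) * (1 - kap / (pc * u)).
      by rewrite /Ymap; field; rewrite u0 pc_neq0.
    transitivity ((Ymap pc - Ymap u) * ((beta * Ymap pc)^-1 * (Ymap u)^-1)).
      by field; rewrite Yp0 Yu0 be0.
    by rewrite E; ring.
  apply: normcM_le; last by rewrite normc_sub.
  apply: le_trans (_ : _ <= 2 * ((normc (beta * Ymap pc))^-1 *
      (2 * (1 - normc kap))^-1)) _; last first.
    by move: b1; lra.
  apply: normcM_le; last apply: normcM_le; rewrite ?Normc.normcV //; last first.
    have Re_Y := disc_Re_Ymap up.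
    rewrite lef_pV2 ?posrE ?normc_gt0 ?mulr_gt0 ?subr_gt0 //.
    exact: le_trans Re_Y (le_trans (ler_norm _) (Re_le_normc _)).
  have u1 : normc u^-1 <= 1.
    rewrite Normc.normcV invf_le1 ?normc_gt0 //.
    exact: le_trans (disc_Re_ge1 up) (le_trans (ler_norm _) (Re_le_normc _)).
  apply: (@le_trans _ _ (1 + h * 1)); last by move: h_le; lra.
  apply: normcD_le; first by rewrite Normc.normc1.
  rewrite normc_opp invfM mulrA; exact: normcM_le.
have good : \forall z \near z0, [/\ tau z != 0, Ymap (tau z) != 0,
    1 + beta * Ymap (tau z) != 0 & normc (Phi (tau z) - pc) < p - 1].
  have ct := @tau_continuous z0.
  have tz0 : tau z0 = t by rewrite /z0 tauK.
  have cY : {for z0, continuous (Ymap \o tau : R[i]^o -> R[i]^o)}.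
    by apply: continuous_comp; [exact: ct|rewrite tz0; exact: Ymap_continuous].
  have cP : {for z0, continuous (Phi \o tau : R[i]^o -> R[i]^o)}.
    by apply: continuous_comp; [exact: ct|rewrite tz0; exact: Phi_continuous].
  have cD : {for z0,
      continuous ((fun z => 1 + beta * (Ymap \o tau) z) : R[i]^o -> R[i]^o)}.
    apply: complex_continuousD; first exact: cst_continuous.
    by apply: complex_continuousM; [exact: cst_continuous|exact: cY].
  have n1 := near_neq0 ct (_ : tau z0 != 0).
  have n2 := near_neq0 cY (_ : (Ymap \o tau) z0 != 0).
  have n3 := near_neq0 cD (_ : 1 + beta * (Ymap \o tau) z0 != 0).
  have n4 := near_disc (c := pc) (r := p - 1) cP
    (_ : normc ((Phi \o tau) z0 - pc) < p - 1).
  rewrite /= tz0 in n1 n2 n3 n4.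
  have {}n1 := n1 t0; have {}n2 := n2 Yt0; have {}n3 := n3 bYt0.
  have {}n4 := n4 Pt.
  by near=> z; split; near: z.
have /nbhs_discP[r r0 rgood] := good.
pose D := [set z : R[i]^o | normc (z - z0) < r].
apply: (@attracted_fatou _ _ (Some @` D) _ l).
- by apply: one_point_compactification_open_some; exact: disc_open.
- by exists z0 => //; rewrite /D /= subrr Normc.normc0.
move=> e e0.
have : (fun n => q ^+ n) @ \oo --> (0 : R).
  by apply: cvg_expr; rewrite ger0_norm.
move=> /cvgr0Pnorm_lt /(_ (e / (C * p))) [].
  by rewrite divr_gt0 // mulr_gt0 //; move: p_ge; lra.
(* The time m splits as two steps to enter the disc, 2 n steps that contract by q^n with n >= N, and
   one further step if m is odd. *)
move=> N _ NP; exists N.+1.*2 => // m /= Nm _ [z Dz <-].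
have [tz0 Ytz0 bYtz0 Ptz] := rgood z Dz.
have mN : (N.+1 <= m./2)%N by rewrite geq_half_double.
rewrite -{1}(odd_double_half m) iterD.
case: m./2 mN => // n Nn.
rewrite -addn1 doubleD iterD.
have -> : iter 1.*2 f (Some z) = f (f (Some z)) by [].
rewrite (tauE z) fmap_even // fmap_odd // iterf ?ltW //.
have [P1 P2] := iterPhi n _ (ltW Ptz).
apply: le_lt_trans (chordal_l _ _ P2) _.
have : q ^+ n < e / (C * p).
  by have := NP n Nn; rewrite ger0_norm ?exprn_ge0.
rewrite ltr_pdivlMr; last by rewrite mulr_gt0 //; move: p_ge; lra.
apply: le_lt_trans; rewrite mulrCA ler_pM2l //.
apply: le_trans P1 _; rewrite ler_wpM2l ?exprn_ge0 //.
by move: Ptz; lra.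
Unshelve. all: by end_near. Qed.

End conjugation.

End renormalized_map.

(** * The finite critical points of f_alpha *)

Section critical_points.
Variable R : realType.
Implicit Types (s z lam alpha : R[i]).

(** Up to the factor -alpha, 1 + 2 z + lambda z^2 is the numerator of the derivative. When it
    vanishes, the difference quotient at z simplifies to [Q k], which is continuous and vanishes at
    k = 0. *)
Lemma critical_point_root lam alpha z : z + z ^+ 2 != 0 ->
  1 + 2 * z + lam * z ^+ 2 = 0 ->
  critical_point (Defs.fmap lam alpha) (Some z).
Proof.
move=> z0 zroot; rewrite /critical_point /= (negPf z0) /=.
pose g (w : R[i]^o) : R[i]^o := alpha * ((1 + lam * w) / (w + w ^+ 2)).
pose Q (k : R[i]^o) : R[i]^o := - alpha * (1 + lam * z) * k /
  ((z + k + (z + k) * (z + k)) * (z + z ^+ 2)).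
have cid (a : R[i]^o) := @complex_continuous_id R a.
have cpoly (a : R[i]^o) :
    {for a, continuous ((fun w => w + w * w) : R[i]^o -> R[i]^o)}.
  exact: (complex_continuousD (cid a) (complex_continuousM (cid a) (cid a))).
have near_dom : \forall w \near (z : R[i]^o), w + w * w != 0.
  by apply: near_neq0; [exact: cpoly|rewrite -expr2].
apply: (@near_eq_is_derive R[i] R[i]^o R[i]^o g).
  apply: filterS near_dom => w w0.
  by rewrite expr2 (negPf w0) /g expr2.
have cadd : {for (0 : R[i]^o),
    continuous ((fun k => z + k) : R[i]^o -> R[i]^o)}.
  by apply: complex_continuousD; [exact: cst_continuous|exact: cid].
have cdom : {for (0 : R[i]^o),
    continuous ((fun k => z + k + (z + k) * (z + k)) : R[i]^o -> R[i]^o)}.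
  exact: (complex_continuousD cadd (complex_continuousM cadd cadd)).
have cQ : {for (0 : R[i]^o), continuous Q}.
  apply: complex_continuousM.
    by apply: complex_continuousM; [exact: cst_continuous|exact: cid].
  apply: complex_continuousV; first by rewrite addr0 -expr2 mulf_neq0.
  by apply: complex_continuousM; [exact: cdom|exact: cst_continuous].
have gQ : (k^-1 *: (g (k *: (1 : R[i]^o) + z) - g z) : R[i]^o)
    @[k --> (0 : R[i]^o)^'] --> (0 : R[i]^o).
  have Q0 : Q 0 = 0 by rewrite /Q mulr0 mul0r.
  have cQ' : Q k @[k --> (0 : R[i]^o)^'] --> (0 : R[i]^o).
    by rewrite -[X in _ --> X]Q0; apply: cvg_within_filter; exact: cQ.
  apply: cvg_trans cQ'; apply: near_eq_cvg.
  have dom0 : \forall k \near (0 : R[i]^o)^', (z + k) + (z + k) * (z + k) != 0.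
    apply: nbhs_dnbhs; apply: (near_neq0 cdom).
    by rewrite addr0 -expr2.
  near=> k.
  have k0 : k != 0 by near: k; rewrite near_withinE; near=> x.
  have zk0 : (z + k) + (z + k) * (z + k) != 0 by near: k.
  have -> : k *: (1 : R[i]^o) = k by exact: mulr1.
  rewrite /Q /g -[RHS]/(k^-1 * _) [k + z]addrC [(z + k) ^+ 2]expr2.
  have zE : 1 + 2 * z + k + lam * z ^+ 2 + lam * z * k = k * (1 + lam * z).
    by rewrite [RHS]mulrDr -[LHS]subr0 -{1}zroot; ring.
  transitivity (- alpha * (1 + 2 * z + k + lam * z ^+ 2 + lam * z * k) /
      (((z + k) + (z + k) * (z + k)) * (z + z ^+ 2))).
    by rewrite zE; field; rewrite zk0 z0.
  by field; rewrite k0 zk0 z0.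
by apply: DeriveDef; [apply/cvg_ex; exists 0|exact: cvg_lim].
Unshelve. all: by end_near. Qed.

(** For lambda = 1 - s^2 the numerator factors as (1 + (1 + s) z)(1 + (1 - s) z). Replacing s by -s
    gives the other root. *)
Lemma critical_points_fmap s alpha : s != 0 -> 1 - s ^+ 2 != 0 ->
  critical_point (Defs.fmap (1 - s ^+ 2) alpha) (Some (- (1 + s)^-1)).
Proof.
move=> s0; have -> : 1 - s ^+ 2 = (1 - s) * (1 + s) by ring.
rewrite mulf_eq0 negb_or => /andP[s1 s2].
apply: critical_point_root; last by field.
have -> : - (1 + s)^-1 + (- (1 + s)^-1) ^+ 2 = - s / (1 + s) ^+ 2 by field.
by rewrite mulf_neq0 ?oppr_eq0 ?invr_eq0 ?sqrf_eq0.
Qed.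

End critical_points.

(** * A large alpha for which c2 is attracted *)

Section attracted_critical_point.
Variable R : realType.

Lemma critical_point_attracted (s : R[i]) (delta : R) :
  0 < complex.Re s -> 1 < normc s -> normc (1 - s ^+ 2) = 1 ->
  exists alpha, [/\ alpha != 0, delta <= normc alpha &
    Defs.fatou (Defs.fmap (1 - s ^+ 2) alpha) (Some (- (1 - s)^-1))].
Proof.
move=> Re_s s_gt1 lam1; set lam := 1 - s ^+ 2.
have s0 : s != 0 by rewrite -normc_gt0; lra.
have lam0 : lam != 0 by rewrite -normc_gt0 lam1.
(* In the coordinate t, v is the critical point -1 / (1 - s). *)
pose v := s^-1; pose kap := v ^+ 2; pose b := (lam - 1) / lam.
have Re_v : 0 < complex.Re v.
  rewrite /v; case: (s) Re_s => x y /= x0.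
  by rewrite divr_gt0 // ltr_pwDl ?exprn_gt0 ?sqr_ge0.
have kap1 : normc kap < 1.
  rewrite /kap expr2 Normc.normcM -expr2 /v Normc.normcV.
  by rewrite expr_lt1 ?invr_ge0 ?normc_ge0 // invf_lt1 //; lra.
have b1 : 1 <= normc b.
  rewrite /b normc_div lam1 divr1 /lam addrAC subrr sub0r normc_opp expr2.
  by rewrite Normc.normcM -expr2 expr_ge1 ?normc_ge0 // ltW.
(* The summands ensure in turn the numerical estimates, |alpha| >= delta, the entry of v into the
   disc, and a contraction factor below 1. *)
pose p : R := 100 + `|delta| + 2 / complex.Re v + 1201 / (1 - normc kap).
have p1 : 0 <= 2 / complex.Re v by rewrite divr_ge0 // ltW.
have p2 : 0 <= 1201 / (1 - normc kap) by rewrite divr_ge0 ?ler0n ?subr_ge0 ?ltW.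
have p3 := normr_ge0 delta.
have p_ge : 100 <= p by rewrite /p; lra.
have vp : 2 <= complex.Re v * (p - 1).
  rewrite mulrC -ler_pdivrMr // /p; lra.
have kp : 1200 < (1 - normc kap) * p.
  rewrite mulrC -ltr_pdivrMr ?subr_gt0 // /p.
  have : 0 < (1 - normc kap)^-1 by rewrite invr_gt0 subr_gt0.
  lra.
have [Y0 bY0 Pv] := first_step kap1 b1 p_ge erefl Re_v vp.
have lam_neq1 : lam != 1.
  apply: contra_neq s0 => l1; apply/eqP; rewrite -sqrf_eq0.
  by rewrite -(subKr 1 (s ^+ 2)) -/lam l1 subrr.
have kapE : kap = (1 - lam)^-1 by rewrite /kap /v /lam subKr exprVn.
exists (b / (lam * beta kap b p)).
have be0 := beta_neq0 kap1 b1 p_ge.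
have v0 : v != 0 by rewrite invr_eq0.
split.
- have b0 : b != 0 by rewrite -normc_gt0; lra.
  apply: mulf_neq0 => //; rewrite invr_eq0; exact: mulf_neq0.
(* It suffices that delta |beta| <= p (12 / p^2) = 12 / p <= 1 <= |b|. *)
- rewrite normc_div [normc (lam * _)]Normc.normcM lam1 mul1r.
  rewrite ler_pdivlMr ?normc_gt0 //.
  have dp : delta <= p by have := ler_norm delta; rewrite /p; lra.
  apply: le_trans (ler_wpM2r (normc_ge0 _) dp) _.
  have p0 : 0 < p by lra.
  apply: le_trans (ler_wpM2l (ltW p0) (beta_le kap1 b1 p_ge)) _.
  have -> : p * (12 * p^-1 ^+ 2) = 12 * p^-1 by field; rewrite gt_eqF.
  rewrite (le_trans _ b1) // ler_pdivrMr //; lra.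
have -> : - (1 - s)^-1 = b * (v + kap).
  have : (1 - s) * (1 + s) != 0 by rewrite (_ : _ * _ = lam) // /lam; ring.
  rewrite mulf_eq0 negb_or => /andP[s1 s2].
  by rewrite /b /kap /v /lam; field; rewrite s0 lam0 s1.
exact: (fatou_attracted_2cycle kap1 b1 p_ge lam0 lam_neq1 erefl kapE v0 Y0 bY0
  Pv kp).
Qed.

End attracted_critical_point.

(** * The range of theta *)

Section rotation.
Variable R : realType.

(** cos(2 pi / 3) is both 2 c^2 - 1 and -c, so c is the positive root of 2 c^2 + c - 1. *)
Lemma cos_pi3 : cos (pi / 3) = 1 / 2 :> R.
Proof.
have pi0 := pi_gt0 R; set c := cos (pi / 3).
have c0 : 0 < c by apply: cos_gt0_pihalf; lra.
have c2 : cos (pi / 3 *+ 2) = 2 * c ^+ 2 - 1 by rewrite cos_mulr2n -/c; ring.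
have : cos (pi - pi / 3) = - c.
  by rewrite addrC cosDpi cosN.
have -> : pi - pi / 3 = pi / 3 *+ 2 :> R by rewrite mulr2n; lra.
rewrite c2; nra.
Qed.

Lemma normc_rotation (theta : R) : normc (rotation theta) = 1.
Proof. by rewrite /= cos2Dsin2 sqrtr1. Qed.

(** |1 - exp(i x)|^2 = 2 - 2 cos x exceeds 1 exactly when cos x < 1/2. For theta > 1/2 the angle is
    reflected to 2 pi - x. *)
Lemma normc_one_sub_rotation (theta : R) : 1 / 6 < theta < 5 / 6 ->
  1 < normc (1 - rotation theta).
Proof.
move=> /andP[t1 t2]; have pi0 := pi_gt0 R.
have cos_lt : cos (2 * pi * theta) < 1 / 2.
  have [thalf|thalf] := leP theta (1 / 2).
    by rewrite -cos_pi3 ltr_cos ?in_itv /=; nra.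
  rewrite -cos_pi3 -cosN -(cosD2pi (- _)) ltr_cos ?in_itv /=; nra.
have : 1 < normc (1 - rotation theta) ^+ 2.
  rewrite sqr_normcE /=; have := cos2Dsin2 (2 * pi * theta); nra.
by rewrite expr_gt1 ?normc_ge0.
Qed.

End rotation.

(* Identification of the labelling of the critical points *)
Local Close Scope classical_set_scope.

Theorem proposition3p6 (R : realType) (theta delta : R)
    (htheta : 1 / 6 < theta < 5 / 6)
    (hbounded : bounded_type theta)
    (hdelta : is_delta theta delta)
    (s : R[i])
    (hs : s ^+ 2 = 1 - rotation theta)
    (hRe : 0 < complex.Re s) :
  let c1 : sphere R := Some (- (1 + s)^-1) in
  let c2 : sphere R := Some (- (1 - s)^-1) in
  (forall alpha : R[i], delta <= Normc.normc alpha ->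
     boundary (Delta0 theta alpha) c1) /\
  (forall alpha : R[i], 0 < Normc.normc alpha <= delta^-1 ->
     boundary (Deltaoo theta alpha) c2).
Proof.
move=> c1 c2.
have lamE : rotation theta = 1 - s ^+ 2 by rewrite hs subKr.
have lam_norm := normc_rotation theta.
have s_gt1 : 1 < normc s.
  have := normc_one_sub_rotation htheta.
  by rewrite -hs expr2 Normc.normcM -expr2 expr_gt1 ?normc_ge0.
rewrite lamE in lam_norm.
have [alpha0 [alpha0_neq0 alpha0_ge c2_fatou]] :=
  critical_point_attracted delta hRe s_gt1 lam_norm.
have s0 : s != 0 by rewrite -normc_gt0; lra.
have lam0 : 1 - s ^+ 2 != 0 by rewrite -normc_gt0 lam_norm.
case: hdelta => _ [a1 [a2 [a12 crit large small]]].
have c1_crit : c1 = a1 \/ c1 = a2.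
  by apply/(crit _ alpha0_neq0); rewrite lamE; exact: critical_points_fmap.
have c2_crit : c2 = a1 \/ c2 = a2.
  apply/(crit _ alpha0_neq0); rewrite lamE -[s ^+ 2]sqrrN.
  by apply: critical_points_fmap; rewrite ?oppr_eq0 ?sqrrN.
have c12 : c1 <> c2.
  move=> [] /oppr_inj /invr_inj /addrI /eqP; rewrite -subr_eq0 opprK -mulr2n.
  by rewrite mulrn_eq0 /= (negPf s0).
(* The labelling is the same for all alpha, so the single parameter [alpha0] decides it: there c2 is
   in the Fatou set, whereas a1 is on the boundary of a Fatou component. *)
have c2_neq_a1 : c2 <> a1.
  move=> c2a1; have [+ _] := large alpha0 alpha0_ge.
  by rewrite -c2a1 /Delta0 lamE; exact: fatou_not_boundary c2_fatou.
have c2a2 : c2 = a2 by case: c2_crit.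
have c1a1 : c1 = a1 by case: c1_crit => // c1a2; case: c12; rewrite c1a2.
split=> alpha alphaP; first by rewrite c1a1; case: (large _ alphaP).
by rewrite c2a2; case: (small _ alphaP).
Qed.
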